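(* Let $A\neq B$ be real $d\times d$ matrices such that the set $\mathscr{A}=\{A,B\}$ is $\tau$-permutable, where $\tau(X)=S^{-1}XS$ with $S$ a nonsingular matrix satisfying $\tau(A)=B$ and $\tau(B)=A$. Suppose that the product $$M=M_kM_{k-1}\cdots M_1,\qquad M_i\in\{A,B\}\ \text{ for } i=1,2,\ldots,k,$$ is spectrum maximizing for $\mathscr{A}$ and that the number $k$ of factors is odd. Then $\tau(M)=\tau(M_k)\cdots\tau(M_1)$ is also a spectrum maximizing product for $\mathscr{A}$, it is different from $M$ up to cyclic permutations of factors, and the products $M$ and $\tau(M)$ have different numbers of factors equal to $A$ and also different numbers of factors equal to $B$.
   Context: A set of two matrices $\mathscr{A}=\{A,B\}$, $A\ne B$, is called $\tau$-permutable if there is a nonsingular matrix $S$ such that the mapping $\tau(X):=S^{-1}XS$ satisfies $\tau(A)=B$ and $\tau(B)=A$. For a finite set $\mathscr{A}$ of real $d\times d$ matrices, let $\bar\rho_n(\mathscr{A})=\max \rho(X_n\cdots X_1)^{1/n}$, the maximum being over all $X_1,\ldots,X_n\in\mathscr{A}$, where $\rho(\cdot)$ of a matrix is its spectral radius. The generalized spectral radius is $\bar\rho(\mathscr{A})=\limsup_{n\to\infty}\bar\rho_n(\mathscr{A})$. A product $X_n\cdots X_1$ of $n$ factors from $\mathscr{A}$ is called spectrum maximizing for $\mathscr{A}$ if $\bar\rho(\mathscr{A})=\rho(X_n\cdots X_1)^{1/n}$. Numbers of factors and cyclic permutations of factors are understood at the level of the ordered tuples of factors (words in the letters $A,B$):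 $M$ corresponds to the tuple $(M_k,\ldots,M_1)$ and $\tau(M)$ to the tuple $(\tau(M_k),\ldots,\tau(M_1))$, whose entries again belong to $\{A,B\}$. ''Different up to cyclic permutations'' means that no cyclic shift of one tuple equals any cyclic shift of the other. *)

(* Defs.v *)
From HB Require Import structures.
From mathcomp Require Import all_boot all_order all_algebra.
From mathcomp Require Import finmap complex.
From mathcomp Require Import classical_sets reals ereal topology normedtype sequences exp.
Set Implicit Arguments.
Unset Strict Implicit.
Unset Printing Implicit Defensive.
Import Order.TTheory GRing.Theory Num.Theory.
Local Open Scope ring_scope.
Local Open Scope complex_scope.

(* Words are listed in the order in which the factors are written: the product
   X_n ... X_1 corresponds to the tuple [tuple X_n; ...; X_1]. *)
Definition wprod (R : realType) (d : nat) (w : seq 'M[R]_d) : 'M[R]_d :=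
  \big[mulmx/1%:M]_(X <- w) X.

(* The eigenvalues are the complex ones: the real matrix is first mapped into
   'M[R[i]]_d. *)
Definition spectrum (R : realType) (d : nat) (A : 'M[R]_d) : set R[i] :=
  [set z | eigenvalue (map_mx (real_complex R) A) z]%classic.

(* The spectrum is finite, and nonempty for d > 0, so the supremum is a
   maximum. *)
Definition spectral_radius (R : realType) (d : nat) (A : 'M[R]_d) : R :=
  sup [set Normc.normc z | z in spectrum A]%classic.

(* The values are nonnegative, so the default 0 of the maximum is harmless. *)
Definition rhobar_ (R : realType) (d : nat) (AA : {fset 'M[R]_d}) (n : nat) : R :=
  \big[Order.max/0]_(t : n.-tuple AA)
    (spectral_radius (wprod [seq val X | X <- t]) `^ n%:R^-1).

Definition generalized_spectral_radius (R : realType) (d : nat)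
    (AA : {fset 'M[R]_d}) : \bar R :=
  limn_esup (fun n => (rhobar_ AA n)%:E).

Definition spectrum_maximizing (R : realType) (d : nat) (AA : {fset 'M[R]_d})
    (n : nat) (w : n.-tuple 'M[R]_d) : Prop :=
  [/\ (0 < n)%N, {subset w <= AA} &
      generalized_spectral_radius AA
      = (spectral_radius (wprod w) `^ n%:R^-1)%:E].

Definition tau (R : realType) (d : nat) (S X : 'M[R]_d) : 'M[R]_d :=
  invmx S *m X *m S.

(* rot i s = s for i >= size s, so i and j may range over all naturals. *)
Definition cyclically_equal (T : eqType) (s t : seq T) : Prop :=
  exists i j : nat, rot i s = rot j t.

(* Main.v *)
Require Import Defs.
From HB Require Import structures.
From mathcomp Require Import all_boot all_order all_algebra.
From mathcomp Require Import finmap complex.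
From mathcomp Require Import classical_sets reals ereal topology normedtype sequences exp.
Set Implicit Arguments.
Unset Strict Implicit.
Unset Printing Implicit Defensive.
Import Order.TTheory GRing.Theory Num.Theory.
Local Open Scope ring_scope.

(** The map [tau] is conjugation by [S], so it is multiplicative on words and
    leaves the complex spectrum, hence the spectral radius, unchanged
    ([tau_wprod], [spectral_radius_tau]).  Since it also permutes {A, B}, the
    word [tau M] has the same length and the same spectral radius as [M], and is
    spectrum maximizing as soon as [M] is.

    On words, [tau] swaps the letters A and B.  So the number of letters A in
    [tau M] is the number of letters B in [M], and the other way round.  The two
    numbers add up to the odd length of [M], hence they differ
    ([count_mem_odd_neq]).  A cyclic shift preserves the number of occurrences
    of each letter, so [M] and [tau M] are not cyclic shifts of each other. *)

Lemma tau_wprod (R : realType) (d : nat) (S : 'M[R]_d) (w : seq 'M[R]_d) :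
  S \in unitmx -> tau S (wprod w) = wprod [seq tau S X | X <- w].
Proof.
move=> unitS; elim: w => [|X w IHw]; rewrite /wprod /=.
  by rewrite !big_nil /tau mulmx1 mulVmx.
rewrite !big_cons -[in RHS]/(wprod _) -IHw /tau !mulmxA.
by rewrite mulmxK.
Qed.

(** Eigenvectors are row vectors: [v] is one of the conjugate exactly when
    [v *m invmx T] is one of [X], for the same eigenvalue. *)
Lemma eigenvalue_conjmx (F : fieldType) (d : nat) (T X : 'M[F]_d) (z : F) :
  T \in unitmx -> eigenvalue (invmx T *m X *m T) z = eigenvalue X z.
Proof.
move=> unitT; apply/eigenvalueP/eigenvalueP=> -[v vX v_neq0].
- exists (v *m invmx T).
    by rewrite scalemxAl -vX -!mulmxA mulmxV // mulmx1.
  by apply: contra_neq v_neq0 => vT0; rewrite -(mulmxKV unitT v) vT0 mul0mx.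
- exists (v *m T).
    by rewrite !mulmxA mulmxK // vX -scalemxAl.
  by apply: contra_neq v_neq0 => vT0; rewrite -(mulmxK unitT v) vT0 mul0mx.
Qed.

Lemma spectrum_tau (R : realType) (d : nat) (S X : 'M[R]_d) :
  S \in unitmx -> spectrum (tau S X) = spectrum X.
Proof.
move=> unitS; apply: boolp.funext => z; rewrite /spectrum /tau /mkset.
by rewrite !map_mxM map_invmx eigenvalue_conjmx ?map_unitmx.
Qed.

Lemma spectral_radius_tau (R : realType) (d : nat) (S X : 'M[R]_d) :
  S \in unitmx -> spectral_radius (tau S X) = spectral_radius X.
Proof. by move=> unitS; rewrite /spectral_radius spectrum_tau. Qed.

Lemma count_mem_two_letters (T : eqType) (a b : T) (s : seq T) :
  a != b -> {in s, forall x, x = a \/ x = b} ->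
  (count_mem a s + count_mem b s)%N = size s.
Proof.
move=> a_neq_b s_ab; rewrite -(count_predC (pred1 a) s); congr addn.
apply: eq_in_count => x /s_ab[] -> /=; first by rewrite eqxx (negPf a_neq_b).
by rewrite eqxx eq_sym a_neq_b.
Qed.

(** Equal numbers would have an even sum, and the sum is the size of [s]. *)
Lemma count_mem_odd_neq (T : eqType) (a b : T) (s : seq T) :
  a != b -> {in s, forall x, x = a \/ x = b} -> odd (size s) ->
  count_mem a s <> count_mem b s.
Proof.
move=> a_neq_b s_ab; rewrite -(count_mem_two_letters a_neq_b s_ab) oddD.
by move=> + eq_ab; rewrite eq_ab addbb.
Qed.

Lemma count_mem_map_swap (T : eqType) (f : T -> T) (a b : T) (s : seq T) :
  a != b -> f a = b -> f b = a -> {in s, forall x, x = a \/ x = b} ->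
  count_mem a (map f s) = count_mem b s.
Proof.
move=> a_neq_b fa fb s_ab; rewrite count_map; apply: eq_in_count => x.
by case/s_ab=> -> /=; rewrite ?fa ?fb ?eqxx // eq_sym.
Qed.

Lemma cyclically_equal_perm (T : eqType) (s t : seq T) :
  cyclically_equal s t -> perm_eq s t.
Proof. by case=> i [j eq_rot]; rewrite -(perm_rot i) eq_rot perm_rot. Qed.

Theorem corollary2p6 (R : realType) (d : nat) (A B S : 'M[R]_d)
    (A_neq_B : A <> B) (S_nonsingular : S \in unitmx)
    (tauA : tau S A = B) (tauB : tau S B = A)
    (k : nat) (M : k.-tuple 'M[R]_d)
    (M_in : forall i : 'I_k, tnth M i = A \/ tnth M i = B)
    (M_max : spectrum_maximizing [fset A; B]%fset M)
    (k_odd : odd k) :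
  [/\ tau S (wprod M) = wprod (map_tuple (tau S) M),
      spectrum_maximizing [fset A; B]%fset (map_tuple (tau S) M),
      ~ cyclically_equal M (map_tuple (tau S) M),
      count_mem A M <> count_mem A (map_tuple (tau S) M) &
      count_mem B M <> count_mem B (map_tuple (tau S) M)].
Proof.
case: M_max => k_gt0 _ rho_M.
have A_neqb_B : A != B by apply/eqP.
have M_AB : {in M, forall X, X = A \/ X = B}.
  by move=> X /tnthP[i ->]; apply: M_in.
have M_BA : {in M, forall X, X = B \/ X = A}.
  by move=> X /M_AB[]; [right | left].
have odd_M : odd (size M) by rewrite size_tuple.
have count_neq := count_mem_odd_neq A_neqb_B M_AB odd_M.
have countA := count_mem_map_swap A_neqb_B tauA tauB M_AB.
have countB : count_mem B (map (tau S) M) = count_mem A M.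
  by apply: count_mem_map_swap; rewrite 1?eq_sym.
have neqA : count_mem A M <> count_mem A (map_tuple (tau S) M).
  by rewrite /= countA.
have radius_tauM :
    spectral_radius (wprod (map_tuple (tau S) M)) = spectral_radius (wprod M).
  by rewrite -(spectral_radius_tau (wprod M) S_nonsingular) tau_wprod.
split.
- exact: tau_wprod.
- split; first exact: k_gt0.
    move=> _ /mapP[X /M_AB X_AB ->]; rewrite !inE.
    by case: X_AB => ->; rewrite ?tauA ?tauB eqxx ?orbT.
  by rewrite radius_tauM.
- by move/cyclically_equal_perm/permP/(_ (pred1 A)).
- exact: neqA.
- by rewrite /= countB => /esym.
Qed.
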